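(* Let $R$ be a ring and let $(\mathcal{T},\mathcal{F})$ be a torsion pair in $\mathrm{Mod}\text{-}R$ with $\mathcal{T}$ definable. The following are equivalent: (1) the module $R_R$ has a $\mathcal{T}$-preenvelope $R\to C$ with $C$ pure projective; (2) $\mathcal{T}$ has enough pure projectives; (3) $\mathcal{T}=\operatorname{Gen}P$ for some pure projective module $P$. Moreover, if these conditions hold, then $(\mathcal{T},\mathcal{F})$ is an elementary torsion pair.
   Context: A full subcategory of $\mathrm{Mod}\text{-}R$ is definable if it is closed under direct products, pure submodules and direct limits; a torsion pair is elementary if both its classes are definable. A module is pure projective if it is a direct summand of a direct sum of finitely presented modules. For a class $\mathcal{C}$, a homomorphism $\phi:M\to C$ with $C\in\mathcal{C}$ is a $\mathcal{C}$-preenvelope if every homomorphism $M\to C'$ with $C'\in\mathcal{C}$ factors through $\phi$. A definable class $\mathcal{D}$ has enough pure projectives if for every $D\in\mathcal{D}$ there is a pure epimorphism $P\to D$ with $P$ a pure projective module in $\mathcal{D}$. $\operatorname{Gen}P$ denotes the class of epimorphic images of direct sums of copies of $P$. *)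

(* Defs.v *)
From HB Require Import structures.
From mathcomp Require Import all_boot all_algebra.
Set Implicit Arguments. Unset Strict Implicit. Unset Printing Implicit Defensive.
Import GRing.Theory.
Local Open Scope ring_scope.

(* Right R-modules (Mod-R) are modelled as left modules over the converse
   ring R^c: for x : M and r : R, the scalar action  r *: x  (r read in R^c)
   is the right action  x . r. *)

Section RightModules.
Variable R : pzRingType.

Notation modR := (lmodType R^c).

Definition cls := modR -> Prop.

Definition surj (M N : modR) (f : M -> N) := forall y, exists x, f x = y.

Definition RR : modR := (R^c)^o.

Definition freeR (n : nat) : modR := 'rV[R^c]_n.

Definition is_coproduct (I : Type) (M : I -> modR) (S : modR)
    (inj : forall i, {linear M i -> S}) : Prop :=
  forall (N : modR) (f : forall i, {linear M i -> N}),
    exists g : {linear S -> N}, (forall i x, g (inj i x) = f i x) /\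
      forall g' : {linear S -> N}, (forall i x, g' (inj i x) = f i x) ->
        forall s, g' s = g s.

Definition is_product (I : Type) (M : I -> modR) (S : modR)
    (pr : forall i, {linear S -> M i}) : Prop :=
  forall (N : modR) (f : forall i, {linear N -> M i}),
    exists g : {linear N -> S}, (forall i x, pr i (g x) = f i x) /\
      forall g' : {linear N -> S}, (forall i x, pr i (g' x) = f i x) ->
        forall s, g' s = g s.

Definition directed_system (I : Type) (le : I -> I -> Prop) (M : I -> modR)
    (phi : forall i j, le i j -> {linear M i -> M j}) : Prop :=
  [/\ (forall i, le i i), (forall i j k, le i j -> le j k -> le i k),
      inhabited I & (forall i j, exists k, le i k /\ le j k)] /\
  (forall i (h : le i i) x, phi i i h x = x) /\
      (forall i j k (hij : le i j) (hjk : le j k) (hik : le i k) x,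
          phi j k hjk (phi i j hij x) = phi i k hik x).

Definition is_direct_limit (I : Type) (le : I -> I -> Prop) (M : I -> modR)
    (phi : forall i j, le i j -> {linear M i -> M j}) (L : modR)
    (u : forall i, {linear M i -> L}) : Prop :=
  (forall i j (h : le i j) x, u j (phi i j h x) = u i x) /\
  forall (N : modR) (f : forall i, {linear M i -> N}),
    (forall i j (h : le i j) x, f j (phi i j h x) = f i x) ->
    exists g : {linear L -> N}, (forall i x, g (u i x) = f i x) /\
      forall g' : {linear L -> N}, (forall i x, g' (u i x) = f i x) ->
        forall s, g' s = g s.

Definition pure_in (M : modR) (S : M -> Prop) : Prop :=
  forall (n m : nat) (r : 'I_n -> 'I_m -> R^c) (b : 'I_m -> M),
    (forall k, S (b k)) ->
    (exists x : 'I_n -> M, forall k, \sum_(j < n) r j k *: x j = b k) ->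
    exists x : 'I_n -> M, (forall j, S (x j)) /\
      forall k, \sum_(j < n) r j k *: x j = b k.

Definition closed_products (C : cls) : Prop :=
  forall (I : Type) (M : I -> modR) (S : modR) (pr : forall i, {linear S -> M i}),
    (forall i, C (M i)) -> @is_product I M S pr -> C S.

Definition closed_pure_submodules (C : cls) : Prop :=
  forall (M N : modR) (i : {linear N -> M}),
    injective i -> @pure_in M (fun m => exists n, i n = m) -> C M -> C N.

Definition closed_direct_limits (C : cls) : Prop :=
  forall (I : Type) (le : I -> I -> Prop) (M : I -> modR)
    (phi : forall i j, le i j -> {linear M i -> M j}) (L : modR)
    (u : forall i, {linear M i -> L}),
    @directed_system I le M phi -> (forall i, C (M i)) ->
    @is_direct_limit I le M phi L u -> C L.

Definition definable (C : cls) : Prop :=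
  [/\ closed_products C, closed_pure_submodules C & closed_direct_limits C].

Definition hom_zero (X Y : modR) : Prop :=
  forall (f : {linear X -> Y}) x, f x = 0.

Definition torsion_pair (T F : cls) : Prop :=
  (forall X, T X <-> forall Y, F Y -> hom_zero X Y) /\
  (forall Y, F Y <-> forall X, T X -> hom_zero X Y).

Definition elementary (T F : cls) : Prop := definable T /\ definable F.

Definition fin_presented (F : modR) : Prop :=
  exists (n m : nat) (p : {linear freeR n -> F}) (q : {linear freeR m -> freeR n}),
    surj p /\ forall v, p v = 0 <-> exists w, q w = v.

Definition pure_projective (P : modR) : Prop :=
  exists (I : Type) (Fm : I -> modR) (S : modR) (inj : forall i, {linear Fm i -> S}),
    [/\ (forall i, fin_presented (Fm i)), @is_coproduct I Fm S inj &
        exists (s : {linear P -> S}) (t : {linear S -> P}), forall x, t (s x) = x].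

Definition pure_epi (P D : modR) (p : {linear P -> D}) : Prop :=
  surj p /\ pure_in (fun x : P => p x = 0).

Definition enough_pure_projectives (C : cls) : Prop :=
  forall D, C D -> exists (P : modR) (p : {linear P -> D}),
    [/\ pure_projective P, C P & pure_epi p].

Definition preenvelope (C : cls) (M Cm : modR) (phi : {linear M -> Cm}) : Prop :=
  C Cm /\ forall (C' : modR) (f : {linear M -> C'}), C C' ->
    exists g : {linear Cm -> C'}, forall x, g (phi x) = f x.

Definition Gen (P : modR) : cls := fun M =>
  exists (I : Type) (S : modR) (inj : forall i : I, {linear P -> S}),
    @is_coproduct I (fun _ => P) S inj /\ exists e : {linear S -> M}, surj e.

End RightModules.

(* Main.v *)
(* A T-preenvelope R -> C with C pure projective makes T = Gen C, and pushing out
   R^n -> C^n along a presentation R^m -> R^n -> G gives a T-preenvelope of the finitely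
   presented module G: a quotient of C^n by a finitely generated submodule, hence again
   pure projective.  The coproduct of these, over all finite systems of relations solved
   in D, maps by a pure epimorphism onto D.  Conversely, R has some T-preenvelope R -> D
   (by a Loewenheim-Skolem argument, as T is closed under products and pure submodules),
   and as R is projective it lifts along any epimorphism P -> D with P in T.  Finally F is
   closed under direct limits because a map from C to a limit of modules M i in F is
   a sum of maps that factor as C -> M i -> lim M i, and Hom(C, M i) = 0. *)
Require Import Defs.
From HB Require Import structures.
From mathcomp Require Import all_boot all_algebra.
From mathcomp Require Import boolp.
Set Implicit Arguments. Unset Strict Implicit. Unset Printing Implicit Defensive.
Import GRing.Theory.
Local Open Scope ring_scope.

Lemma dep_choice (I : Type) (X : I -> Type) (P : forall i, X i -> Prop) :
  (forall i, exists x, P i x) -> exists f : forall i, X i, forall i, P i (f i).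
Proof. by move=> H; exists (fun i => projT1 (cid (H i))) => i; case: (cid _). Qed.

(** * Modules as quotients by congruences *)

Section Modules.
Variable K : pzRingType.
Notation modK := (lmodType K).

Lemma linear_exists (M N : modK) (f : M -> N) : linear f ->
  exists g : {linear M -> N}, g =1 f.
Proof.
move=> lf; pose mx := GRing.isLinear.Build K M N *:%R f lf.
pose g : {linear M -> N} := HB.pack f mx.
by exists g.
Qed.

Section Congruence.
Variables (A : Type) (z : A) (add : A -> A -> A) (sc : K -> A -> A).
Variable E : A -> A -> Prop.

(** [A] carries no algebraic structure of its own: lists, families or terms satisfy the module
    axioms only up to [E]. Negation is scaling by -1. *)
Record module_congruence : Prop := ModuleCongruence {
  congr_refl : forall a, E a a;
  congr_sym : forall a b, E a b -> E b a;
  congr_trans : forall a b c, E a b -> E b c -> E a c;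
  congr_add : forall a a' b b', E a a' -> E b b' -> E (add a b) (add a' b');
  congr_sc : forall r a a', E a a' -> E (sc r a) (sc r a');
  congr_addA : forall a b c, E (add a (add b c)) (add (add a b) c);
  congr_addC : forall a b, E (add a b) (add b a);
  congr_add0 : forall a, E (add z a) a;
  congr_addN : forall a, E (add (sc (-1) a) a) z;
  congr_scA : forall r s a, E (sc r (sc s a)) (sc (r * s) a);
  congr_sc1 : forall a, E (sc 1 a) a;
  congr_scDr : forall r a b, E (sc r (add a b)) (add (sc r a) (sc r b));
  congr_scDl : forall r s a, E (sc (r + s) a) (add (sc r a) (sc s a)) }.

Hypothesis HE : module_congruence.

(** Classes are predicates on [A], so equality of classes reduces to [E] by extensionality. *)
Definition congr_class : Type := {c : A -> Prop | exists a, c = E a}.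
Let cl (a : A) : congr_class := exist _ (E a) (ex_intro _ a erefl).
Let rep (q : congr_class) : A := projT1 (cid (proj2_sig q)).

Let clP a b : cl a = cl b <-> E a b.
Proof.
split=> [[eab]|eab].
  by apply: (congr_sym HE); rewrite -eab; apply: congr_refl HE _.
rewrite /cl; apply: eq_exist; apply: funext => c; apply: propext.
split; apply: (congr_trans HE) => //; exact: (congr_sym HE).
Qed.

Let repK q : cl (rep q) = q.
Proof.
rewrite /rep; case: q => c h /=; case: (cid _) => a /= cE.
by apply: eq_exist; rewrite cE.
Qed.

Let rep_cl a : E (rep (cl a)) a.
Proof. by apply/clP; rewrite repK. Qed.

Let cadd p q := cl (add (rep p) (rep q)).
Let copp q := cl (sc (-1) (rep q)).
Let csc r q := cl (sc r (rep q)).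

Let caddE a b : cadd (cl a) (cl b) = cl (add a b).
Proof. by apply/clP; apply: (congr_add HE); apply: rep_cl. Qed.

Let cscE r a : csc r (cl a) = cl (sc r a).
Proof. by apply/clP; apply: (congr_sc HE); apply: rep_cl. Qed.

Let caddA : associative cadd.
Proof.
by move=> a b c; rewrite -[a]repK -[b]repK -[c]repK !caddE; apply/clP/congr_addA.
Qed.
Let caddC : commutative cadd.
Proof. by move=> a b; apply/clP/congr_addC. Qed.
Let cadd0 : left_id (cl z) cadd.
Proof. by move=> a; rewrite -[a]repK caddE; apply/clP/congr_add0. Qed.
Let caddN : left_inverse (cl z) copp cadd.
Proof.
move=> a; rewrite -[a]repK /copp caddE; apply/clP.
by rewrite repK; apply: congr_addN.
Qed.

HB.instance Definition _ := gen_eqMixin congr_class.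
HB.instance Definition _ := gen_choiceMixin congr_class.
HB.instance Definition _ :=
  GRing.isZmodule.Build congr_class caddA caddC cadd0 caddN.

Let cscA r s q : csc r (csc s q) = csc (r * s) q.
Proof. by rewrite -[q]repK !cscE; apply/clP/congr_scA. Qed.
Let csc1 : left_id 1 csc.
Proof. by move=> q; rewrite -[q]repK cscE; apply/clP/congr_sc1. Qed.
Let cscDr : right_distributive csc +%R.
Proof.
move=> r p q; rewrite -[p]repK -[q]repK.
rewrite -[_ + _]/(cadd _ _) -[RHS]/(cadd _ _) !(cscE, caddE).
exact/clP/congr_scDr.
Qed.
Let cscDl q : {morph csc^~ q : r s / r + s}.
Proof.
move=> r s; rewrite -[q]repK.
by rewrite -[RHS]/(cadd _ _) !(cscE, caddE); apply/clP/congr_scDl.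
Qed.
HB.instance Definition _ :=
  GRing.Zmodule_isLmodule.Build K congr_class cscA csc1 cscDr cscDl.

Lemma congruence_module : exists (M : modK) (p : A -> M),
  [/\ forall m, exists a, p a = m, forall a b, p a = p b <-> E a b,
      p z = 0, forall a b, p (add a b) = p a + p b &
      forall r a, p (sc r a) = r *: p a].
Proof.
exists congr_class, cl; split=> //.
by move=> m; exists (rep m).
Qed.

End Congruence.

Lemma quotient_module (M : modK) (S : M -> Prop) :
  S 0 -> (forall x y, S x -> S y -> S (x + y)) ->
  (forall r x, S x -> S (r *: x)) ->
  exists (Q : modK) (p : {linear M -> Q}),
    (forall q, exists x, p x = q) /\ forall x, p x = 0 <-> S x.
Proof.
move=> S0 SD SZ; pose E (x y : M) := S (x - y).
have E0 x y : x = y -> E x y by move=> ->; rewrite /E subrr.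
have SN x : S x -> S (- x) by rewrite -scaleN1r; apply: SZ.
have HE : module_congruence 0 +%R *:%R E.
  split; rewrite /E.
  - by move=> a; apply: E0.
  - by move=> a b /SN; rewrite opprB.
  - by move=> a b c /SD H /H; rewrite addrA subrK.
  - by move=> a a' b b' /SD H /H; rewrite opprD addrACA.
  - by move=> r a a' /(SZ r); rewrite scalerBr.
  - by move=> a b c; apply: E0; rewrite addrA.
  - by move=> a b; apply: E0; rewrite addrC.
  - by move=> a; apply: E0; rewrite add0r.
  - by move=> a; apply: E0; rewrite scaleN1r addNr.
  - by move=> r s a; apply: E0; rewrite scalerA.
  - by move=> a; apply: E0; rewrite scale1r.
  - by move=> r a b; apply: E0; rewrite scalerDr.
  - by move=> r s a; apply: E0; rewrite scalerDl.
have [Q [p [psurj pE p0 pD pZ]]] := congruence_module HE.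
have [q qE] : exists q : {linear M -> Q}, q =1 p.
  by apply: linear_exists => r x y; rewrite pD pZ.
exists Q, q; split=> [y|x]; first by have [x <-] := psurj y; exists x.
by rewrite qE -p0 pE /E subr0.
Qed.

(* One construction yields products, images and coproducts: the maps ev play the
   role of coordinates, of an evaluation map, and of all test maps out of the
   coproduct, respectively.  The index type J is only quantified over in Prop, so it
   may be large. *)
Lemma separated_module (A : Type) (z : A) (add : A -> A -> A) (sc : K -> A -> A)
    (J : Type) (N : J -> modK) (ev : forall j, A -> N j) :
  (forall j, ev j z = 0) ->
  (forall j a b, ev j (add a b) = ev j a + ev j b) ->
  (forall j r a, ev j (sc r a) = r *: ev j a) ->
  exists (M : modK) (p : A -> M),
    [/\ forall m, exists a, p a = m,
        forall a b, p a = p b <-> forall j, ev j a = ev j b,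
        p z = 0, forall a b, p (add a b) = p a + p b &
        forall r a, p (sc r a) = r *: p a].
Proof.
move=> e0 eD eZ; apply: congruence_module; split.
- by [].
- by move=> a b H j.
- by move=> a b c H1 H2 j; rewrite H1.
- by move=> a a' b b' H1 H2 j; rewrite !eD H1 H2.
- by move=> r a a' H j; rewrite !eZ H.
- by move=> a b c j; rewrite !eD addrA.
- by move=> a b j; rewrite !eD addrC.
- by move=> a j; rewrite eD e0 add0r.
- by move=> a j; rewrite eD eZ e0 scaleN1r addNr.
- by move=> r s a j; rewrite !eZ scalerA.
- by move=> a j; rewrite eZ scale1r.
- by move=> r a b j; rewrite !(eD, eZ) scalerDr.
- by move=> r s a j; rewrite !(eD, eZ) scalerDl.
Qed.

(** Choose a section of [p]; since [f] depends only on the value of [p], composing it with the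
    section is linear. Here [A] may be a mere type of terms. *)
Lemma factor_operations (A : Type) (add : A -> A -> A) (sc : K -> A -> A)
    (N L : modK) (p : A -> N) (f : A -> L) :
  (forall a b, p (add a b) = p a + p b) -> (forall r a, p (sc r a) = r *: p a) ->
  (forall a b, f (add a b) = f a + f b) -> (forall r a, f (sc r a) = r *: f a) ->
  (forall y, exists a, p a = y) -> (forall a b, p a = p b -> f a = f b) ->
  exists g : {linear N -> L}, forall a, g (p a) = f a.
Proof.
move=> pD pZ fD fZ psurj pf; have [s sK] := choice psurj.
have [g gE] : exists g : {linear N -> L}, g =1 f \o s.
  by apply: linear_exists => r x y /=; rewrite -fZ -fD; apply: pf; rewrite pD pZ !sK.
by exists g => a; rewrite gE; apply: pf; rewrite sK.
Qed.

Lemma factor_through (M N L : modK) (p : {linear M -> N}) (f : {linear M -> L}) :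
  (forall y, exists x, p x = y) -> (forall x, p x = 0 -> f x = 0) ->
  exists g : {linear N -> L}, forall x, g (p x) = f x.
Proof.
move=> psurj kf.
apply: (@factor_operations M +%R *:%R) ; do ?[exact: linearD | exact: linearZZ | by []].
move=> x y /eqP; rewrite -subr_eq0 -linearB => /eqP/kf/eqP.
by rewrite linearB subr_eq0 => /eqP.
Qed.

End Modules.

(** * Products and coproducts *)

Section Universal.
Variable R : pzRingType.
Notation modR := (lmodType R^c).
Implicit Types M N P S : modR.

Lemma product_exists (I : Type) (M : I -> modR) :
  exists S (pr : forall i, {linear S -> M i}),
    is_product pr /\ forall x : forall i, M i, exists s, forall i, pr i s = x i.
Proof.
have [S [p [psurj pE p0 pD pZ]]] := @separated_module R^c (forall i, M i)
  (fun i => 0) (fun x y i => x i + y i) (fun r x i => r *: x i) I M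
  (fun i x => x i) (fun=> erefl) (fun _ _ _ => erefl) (fun _ _ _ => erefl).
have [s sK] := choice psurj.
have spE x i : s (p x) i = x i by have /pE := sK (p x).
have prP i : linear (fun q : S => s q i : M i).
  move=> r x y; by rewrite -[x in LHS]sK -[y in LHS]sK -pZ -pD spE.
have [pr prE] := dep_choice (fun i => linear_exists (@prP i)).
exists S, pr; split=> [N f|x]; last by exists (p x) => i; rewrite prE spE.
have [g gE] : exists g : {linear N -> S}, g =1 (fun x => p (fun i => f i x)).
  apply: linear_exists => r x y; rewrite -pZ -pD; apply/pE => i.
  by rewrite linearP.
exists g; split=> [i x|g' g'E x]; first by rewrite prE gE spE.
by rewrite -[LHS]sK -[RHS]sK; apply/pE => i; rewrite -!prE g'E gE prE spE.
Qed.

(** Elements are finite lists of tagged elements, added by concatenation, and two lists are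
    identified when every family of maps out of the [M i] gives them the same sum. No equality test
    on [I] is involved. *)
Lemma coproduct_exists (I : Type) (M : I -> modR) :
  exists S (inj : forall i, {linear M i -> S}), is_coproduct inj.
Proof.
pose A := seq {i : I & M i}.
pose ev (N : modR) (f : forall i, {linear M i -> N}) (l : A) : N :=
  \sum_(x <- l) f (tag x) (tagged x).
pose J := {N : modR & forall i, {linear M i -> N}}.
pose tg i (x : M i) : {i : I & M i} := existT _ i x.
pose sc (r : R^c) (l : A) : A :=
  map (fun x : {i : I & M i} => tg (tag x) (r *: (tagged x : M (tag x)))) l.
have evZ N f r l : @ev N f (sc r l) = r *: ev N f l.
  by rewrite /ev big_map scaler_sumr; apply: eq_bigr => x _; rewrite linearZ.
have evD N f l l' : @ev N f (l ++ l') = ev N f l + ev N f l' by exact: big_cat.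
have [||| S [p [psurj pE p0 pD pZ]]] := @separated_module R^c A [::] cat sc J
  (fun j => tag j) (fun j => ev (tag j) (tagged j)).
- by move=> j; rewrite /ev big_nil.
- by move=> j a b; exact: evD.
- by move=> j r a; exact: evZ.
pose ij i x := p [:: tg i x].
have ijP i : linear (@ij i).
  move=> r x y; rewrite -pZ -pD; apply/pE => -[N f].
  by rewrite evD evZ /ev !big_seq1 linearP.
have [inj injE] := dep_choice (fun i => linear_exists (@ijP i)).
exists S, inj => N f.
have [s sK] := choice psurj.
have spE l : ev N f (s (p l)) = ev N f l.
  by have /pE/(_ (Tagged (fun N : modR => forall i, {linear M i -> N}) f)) := sK (p l).
have [g gE] : exists g : {linear S -> N}, g =1 (fun x => ev N f (s x)).
  apply: linear_exists => r x y.
  by rewrite -[x in LHS]sK -[y in LHS]sK -pZ -pD spE evD evZ.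
exists g; split=> [i x|g' g'E x]; first by rewrite gE injE spE /ev big_seq1.
rewrite -[x]sK gE spE; elim: (s x) => [|[i y] l IH].
  by rewrite p0 linear0 /ev big_nil.
rewrite -cat1s pD linearD IH evD; congr (_ + _).
by rewrite /ev big_seq1 /= -g'E injE.
Qed.

(** The quotient map by the submodule [C] and the zero map agree on every [inj i], so they are equal
    by uniqueness. *)
Lemma coproduct_ind (I : Type) (M : I -> modR) S (inj : forall i, {linear M i -> S})
    (C : S -> Prop) : is_coproduct inj ->
  C 0 -> (forall x y, C x -> C y -> C (x + y)) -> (forall r x, C x -> C (r *: x)) ->
  (forall i x, C (inj i x)) -> forall s, C s.
Proof.
move=> Sc C0 CD CZ Ci s; have [Q [p [_ pE]]] := quotient_module C0 CD CZ.
have [g [_ gU]] := Sc Q (fun i => \0).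
have ps : p s = g s by apply: gU => i x; apply/pE.
by apply/pE; rewrite ps -(gU \0).
Qed.

Lemma coproduct_proj (I : eqType) (M : I -> modR) S (inj : forall i, {linear M i -> S}) :
  is_coproduct inj -> exists pr : forall i, {linear S -> M i},
    (forall i x, pr i (inj i x) = x) /\
    (forall i j x, i != j -> pr i (inj j x) = 0).
Proof.
move=> Sc.
(* A Kronecker delta of linear maps: the identity, up to a cast, on the diagonal and zero
   elsewhere. *)
have dP (ij : I * I) : exists d : {linear M ij.2 -> M ij.1},
    (forall e : ij.1 = ij.2, forall x, d (ecast i (M i) e x) = x) /\
    (ij.1 != ij.2 -> forall x, d x = 0).
  case: ij => i j /=; case: (eqVneq i j) => [<-|ij].
    by exists idfun; split=> // e x; rewrite eq_axiomK.
  by exists \0; split=> // e; rewrite e eqxx in ij.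
have [d {}dP] := dep_choice dP.
have [pr prE] := dep_choice (fun i => Sc (M i) (fun j => d (i, j))).
exists pr; split=> [i x|i j x ij].
  by rewrite (prE i).1 ((dP (i, i)).1 erefl).
by rewrite (prE i).1 (dP (i, j)).2.
Qed.

End Universal.

(** Both sums reduce to the indices common to [J] and [J'], since [h] vanishes at all others. *)
Lemma big_support (I : eqType) (V : nmodType) (h : I -> V) (J J' : seq I) :
  uniq J -> uniq J' -> (forall i, i \notin J -> h i = 0) ->
  (forall i, i \notin J' -> h i = 0) -> \sum_(i <- J) h i = \sum_(i <- J') h i.
Proof.
have aux (A B : seq I) : (forall i, i \notin B -> h i = 0) ->
    \sum_(i <- A) h i = \sum_(i <- [seq i <- A | i \in B]) h i.
  move=> hB; rewrite big_filter [LHS](bigID (mem B)) /= [X in _ + X]big1 ?addr0 //.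
move=> uJ uJ' hJ hJ'; rewrite (aux J J') // (aux J' J) //; apply: perm_big.
by apply: uniq_perm; rewrite ?filter_uniq // => i; rewrite !mem_filter andbC.
Qed.

(** * Finitely presented modules *)

Section FinitelyPresented.
Variable R : pzRingType.
Notation modR := (lmodType R^c).
Implicit Types M N P Q F G : modR.

Definition span M (m : nat) (X : 'I_m -> M) (x : M) : Prop :=
  exists c : 'I_m -> R^c, x = \sum_k c k *: X k.

Lemma span_gen M m (X : 'I_m -> M) k : span X (X k).
Proof.
exists (fun j => (j == k)%:R); rewrite (bigD1 k) //= eqxx scale1r big1 ?addr0 //.
by move=> i /negPf ->; rewrite scale0r.
Qed.

Lemma quotient_span M m (X : 'I_m -> M) :
  exists (Q : modR) (p : {linear M -> Q}), surj p /\ forall x, p x = 0 <-> span X x.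
Proof.
apply: quotient_module.
- by exists (fun=> 0); rewrite big1 // => k _; rewrite scale0r.
- move=> _ _ [c ->] [d ->]; exists (fun k => c k + d k).
  by rewrite -big_split; apply: eq_bigr => k _; rewrite scalerDl.
- move=> r _ [c ->]; exists (fun k => r * c k).
  by rewrite scaler_sumr; apply: eq_bigr => k _; rewrite scalerA.
Qed.

Lemma free_hom n N (d : 'I_n -> N) :
  exists f : {linear freeR R n -> N}, forall v, f v = \sum_j v 0 j *: d j.
Proof.
apply: linear_exists => r x y; rewrite scaler_sumr -big_split; apply: eq_bigr => j _ /=.
by rewrite !mxE scalerDl scalerA.
Qed.

Lemma fin_presented_free n : fin_presented (freeR R n).
Proof.
exists n, 0, idfun, \0; split=> [v|v]; first by exists v.
by split=> [v0|[w w0]]; [exists 0; exact: esym v0 | exact: esym w0].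
Qed.

Lemma fin_presented_pair F G : fin_presented F -> fin_presented G ->
  fin_presented (F * G)%type.
Proof.
move=> [n [m [p [q [psurj pq]]]]] [n' [m' [p' [q' [psurj' pq']]]]].
have [P PE] : exists P : {linear freeR R (n + n') -> (F * G)%type},
    P =1 (fun v => (p (lsubmx v), p' (rsubmx v))).
  by apply: linear_exists => r x y; rewrite !linearP.
have [Q QE] : exists Q : {linear freeR R (m + m') -> freeR R (n + n')},
    Q =1 (fun w => row_mx (q (lsubmx w)) (q' (rsubmx w))).
  apply: linear_exists => r x y.
  by rewrite !linearP scale_row_mx add_row_mx.
exists (n + n')%N, (m + m')%N, P, Q; split=> [[x y]|v].
  have [[a ax] [b bx]] := (psurj x, psurj' y).
  by exists (row_mx a b); rewrite PE row_mxKl row_mxKr ax bx.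
rewrite PE -[0]/(0, 0); split=> [[/pq[w wv] /pq'[w' wv']]|[w <-]].
  by exists (row_mx w w'); rewrite QE row_mxKl row_mxKr wv wv' hsubmxK.
rewrite QE row_mxKl row_mxKr; congr pair; first by apply/pq; eexists.
by apply/pq'; eexists.
Qed.

(** The relations of [F], together with lifts [Y] of the new relations [X] to the free module,
    present [Q]. *)
Lemma fin_presented_quotient F Q m (X : 'I_m -> F) (p : {linear F -> Q}) :
  fin_presented F -> surj p -> (forall x, p x = 0 <-> span X x) -> fin_presented Q.
Proof.
move=> [n [l [f [q [fsurj fq]]]]] psurj pX.
have [Y YX] := choice (fun k => fsurj (X k)).
have [h hE] := free_hom Y.
have [Z ZE] : exists Z : {linear freeR R (l + m) -> freeR R n},
    Z =1 (fun w => q (lsubmx w) + h (rsubmx w)).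
  by apply: linear_exists => r x y; rewrite !linearP scalerDr addrACA.
exists n, (l + m)%N, (p \o f), Z; split=> [y|v].
  by have [x <-] := psurj y; have [v <-] := fsurj x; exists v.
have fh w : f (h w) = \sum_k w 0 k *: X k.
  by rewrite hE linear_sum; apply: eq_bigr => k _; rewrite linearZ YX.
rewrite /=; split=> [/pX[c cE]|[w <-]].
  have /fq[w wE] : f (v - h (\row_k c k)) = 0.
    rewrite linearB fh cE; apply/eqP; rewrite subr_eq0; apply/eqP.
    by apply: eq_bigr => k _; rewrite mxE.
  by exists (row_mx w (\row_k c k)); rewrite ZE row_mxKl row_mxKr wE subrK.
rewrite ZE linearD (_ : f (q _) = 0) ?add0r; last by apply/fq; eexists.
by apply/pX; rewrite fh; eexists.
Qed.

(** Translates maps out of [F] into solutions of a finite linear system: [e] is the image of the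
    standard basis under [p], and the coefficients [r] are the coordinates of [q] on basis
    vectors. *)
Lemma fin_presented_relations F : fin_presented F ->
  exists n m (r : 'I_n -> 'I_m -> R^c) (e : 'I_n -> F),
  [/\ forall k, \sum_j r j k *: e j = 0,
      forall N (d : 'I_n -> N), (forall k, \sum_j r j k *: d j = 0) ->
        exists h : {linear F -> N}, forall j, h (e j) = d j &
      forall N (f g : {linear F -> N}), (forall j, f (e j) = g (e j)) -> f =1 g].
Proof.
move=> [n [m [p [q [psurj pq]]]]].
pose dl l (j : 'I_l) : freeR R l := delta_mx 0 j.
have dE l (v : freeR R l) : v = \sum_j v 0 j *: dl l j by exact: row_sum_delta.
exists n, m, (fun j k => q (dl m k) 0 j), (fun j => p (dl n j)); split.
- move=> k; transitivity (p (q (dl m k))); last by apply/pq; eexists.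
  by rewrite [in RHS](dE _ (q _)) linear_sum; apply: eq_bigr => j _; rewrite linearZ.
- move=> N d dr; have [f fE] := free_hom d.
  have [v /pq[w <-]|h hE] := factor_through (f := f) psurj.
    rewrite (dE _ w) !linear_sum big1 // => k _.
    by rewrite !linearZ fE /= dr scaler0.
  exists h => j; rewrite hE fE (bigD1 j) //= mxE !eqxx scale1r big1 ?addr0 //.
  by move=> i ij; rewrite mxE (negPf ij) andbF scale0r.
- move=> N f g fg x; have [v <-] := psurj x; rewrite (dE _ v) !linear_sum.
  by apply: eq_bigr => j _; rewrite !linearZ /= fg.
Qed.

End FinitelyPresented.

(** * Pure projective modules through dual bases *)

Section DualBasis.
Variable R : pzRingType.
Notation modR := (lmodType R^c).
Implicit Types M N P Q S F G : modR.

Definition expansion (I : eqType) (G : I -> modR) P (a : forall i, {linear G i -> P})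
    (b : forall i, {linear P -> G i}) (x : P) : Prop :=
  exists J : seq I,
    [/\ uniq J, forall i, i \notin J -> b i x = 0 & x = \sum_(i <- J) a i (b i x)].

(* An intrinsic form of pure projectivity: P is a direct summand of a coproduct of
   the finitely presented modules G i via the maps a and b. *)
Definition dual_basis P : Prop :=
  exists (I : eqType) (G : I -> modR) (a : forall i, {linear G i -> P})
      (b : forall i, {linear P -> G i}),
    (forall i, fin_presented (G i)) /\ forall x, expansion a b x.

(** With the next two lemmas, this makes the elements that have an expansion a submodule, as
    [coproduct_ind] requires. *)
Lemma expansionD (I : eqType) (G : I -> modR) P (a : forall i, {linear G i -> P})
    (b : forall i, {linear P -> G i}) x y :
  expansion a b x -> expansion a b y -> expansion a b (x + y).
Proof.
move=> [J [uJ bJ xJ]] [J' [uJ' bJ' yJ]]; pose J2 := undup (J ++ J').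
have nJ i : i \notin J2 -> b i x = 0 /\ b i y = 0.
  by rewrite mem_undup mem_cat negb_or => /andP[/bJ -> /bJ' ->].
exists J2; split; first exact: undup_uniq.
  by move=> i /nJ[bx b_y]; rewrite linearD bx b_y addr0.
rewrite {1}xJ {1}yJ.
rewrite (@big_support _ _ (fun i => a i (b i x)) J J2) ?undup_uniq //.
- rewrite (@big_support _ _ (fun i => a i (b i y)) J' J2) ?undup_uniq //.
  + by rewrite -big_split; apply: eq_bigr => i _; rewrite !linearD.
  + by move=> i /bJ' ->; rewrite linear0.
  + by move=> i /nJ[_ ->]; rewrite linear0.
- by move=> i /bJ ->; rewrite linear0.
- by move=> i /nJ[-> _]; rewrite linear0.
Qed.

Lemma expansionZ (I : eqType) (G : I -> modR) P (a : forall i, {linear G i -> P})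
    (b : forall i, {linear P -> G i}) r x :
  expansion a b x -> expansion a b (r *: x).
Proof.
move=> [J [uJ bJ xJ]]; exists J; split=> // [i /bJ bx|].
  by rewrite linearZ /= bx scaler0.
by rewrite {1}xJ scaler_sumr; apply: eq_bigr => i _; rewrite !linearZ.
Qed.

Lemma expansion0 (I : eqType) (G : I -> modR) P (a : forall i, {linear G i -> P})
    (b : forall i, {linear P -> G i}) : expansion a b 0.
Proof. by exists [::]; split=> // [i _|]; rewrite ?linear0 ?big_nil. Qed.

Lemma dual_basis_fin_presented F : fin_presented F -> dual_basis F.
Proof.
move=> fpF; exists unit, (fun=> F), (fun=> idfun), (fun=> idfun); split=> // x.
by exists [:: tt]; split=> [|[]|]; rewrite ?big_seq1.
Qed.

Lemma dual_basis_retract P Q (s : {linear P -> Q}) (t : {linear Q -> P}) :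
  (forall x, t (s x) = x) -> dual_basis Q -> dual_basis P.
Proof.
move=> ts [I [G [a [b [fpG ab]]]]].
exists I, G, (fun i => t \o a i), (fun i => b i \o s); split=> // x.
have [J [uJ bJ xJ]] := ab (s x); exists J; split=> //.
by rewrite -{1}[x]ts {1}xJ linear_sum.
Qed.

Lemma dual_basis_coproduct (I : Type) (P : I -> modR) S (inj : forall i, {linear P i -> S}) :
  is_coproduct inj -> (forall i, dual_basis (P i)) -> dual_basis S.
Proof.
(* [{classic I}] equips the arbitrary index type with the decidable equality that projections
   need. *)
move=> Sc DP; have [pr [prK pr0]] := @coproduct_proj R {classic I} P S inj Sc.
have {DP} [L DP] := dep_choice DP; have {DP} [G DP] := dep_choice DP.
have {DP} [a DP] := dep_choice DP; have {DP} [b DP] := dep_choice DP.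
pose U := {i : {classic I} & L i}.
exists U, (fun u => G (tag u) (tagged u)),
  (fun u => inj (tag u) \o a (tag u) (tagged u)),
  (fun u => b (tag u) (tagged u) \o pr (tag u)).
split=> [u|]; first by have [fpG _] := DP (tag u).
apply: (coproduct_ind Sc); [exact: expansion0| exact: expansionD| exact: expansionZ |].
move=> i x; have [_ /(_ x) [J [uJ bJ xJ]]] := DP i.
exists [seq (Tagged L k : U) | k <- J]; split.
- by rewrite map_inj_uniq // => k l /eqP; rewrite eq_Tagged => /eqP.
- move=> [j k] /= nJ; have [ji|ji] := eqVneq j i; last by rewrite pr0 ?linear0.
  move: k nJ; rewrite {}ji => k nJ; rewrite prK bJ //.
  by apply: contra nJ => kJ; apply/mapP; exists k.
- by rewrite big_map /= prK {1}xJ linear_sum.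
Qed.

Lemma pure_projective_dual_basis P : pure_projective P <-> dual_basis P.
Proof.
split=> [[I [G [S [inj [fpG Sc [s [t ts]]]]]]]|].
  apply: (dual_basis_retract ts); apply: (dual_basis_coproduct Sc) => i.
  exact: dual_basis_fin_presented.
move=> [I [G [a [b [fpG ab]]]]].
have [S [inj Sc]] := coproduct_exists G.
exists I, G, S, inj; split=> //.
have [t [tE _]] := Sc P a; have [J JP] := choice ab.
have J0 i x : i \notin J x -> inj i (b i x) = 0.
  by case: (JP x) => _ bJ _ /bJ ->; rewrite linear0.
(* The support [J x] is chosen for each [x] separately; linearity of the section [s] is checked over
   one finite set [B] containing all supports involved. *)
have sumJ x B : uniq B -> (forall i, i \notin B -> inj i (b i x) = 0) ->
    \sum_(i <- J x) inj i (b i x) = \sum_(i <- B) inj i (b i x).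
  case: (JP x) => uJ _ _ uB B0.
  by rewrite (@big_support _ _ (fun i => inj i (b i x)) _ B) // => i; apply: J0.
have [s sE] : exists s : {linear P -> S}, s =1 fun x => \sum_(i <- J x) inj i (b i x).
  apply: linear_exists => r x y; pose B := undup (J x ++ J y ++ J (r *: x + y)).
  have uB : uniq B by exact: undup_uniq.
  have BP i : i \notin B -> [/\ i \notin J x, i \notin J y & i \notin J (r *: x + y)].
    by rewrite mem_undup !mem_cat !negb_or => /and3P.
  rewrite !(fun z => sumJ z B uB); try by move=> i /BP[? ? ?]; apply: J0.
  rewrite scaler_sumr -big_split; apply: eq_bigr => i _.
  by rewrite !linearP.
exists s, t => x; rewrite sE linear_sum; have [_ _ xJ] := JP x; rewrite [RHS]xJ.
by apply: eq_bigr => i _.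
Qed.

(** [F] is the direct sum of the [G i] for [i] in the list [J], built one index at a time. *)
Lemma finite_part_factors (I : eqType) (G : I -> modR) P (a : forall i, {linear G i -> P})
    (b : forall i, {linear P -> G i}) (J : seq I) : (forall i, fin_presented (G i)) ->
  exists F (b' : {linear P -> F}) (a' : {linear F -> P}),
    fin_presented F /\ forall x, a' (b' x) = \sum_(i <- J) a i (b i x).
Proof.
move=> fpG; elim: J => [|i J [F [b' [a' [fpF ab']]]]].
  exists (freeR R 0), \0, \0; split=> [|x]; first exact: fin_presented_free.
  by rewrite big_nil.
have [b2 b2E] : exists f : {linear P -> (G i * F)%type}, f =1 fun x => (b i x, b' x).
  by apply: linear_exists => r x y; rewrite !linearP.
have [a2 a2E] : exists f : {linear (G i * F)%type -> P}, f =1 fun x => a i x.1 + a' x.2.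
  by apply: linear_exists => r x y; rewrite !linearP scalerDr addrACA.
exists (G i * F)%type, b2, a2; split=> [|x]; first exact: fin_presented_pair.
by rewrite a2E b2E big_cons ab'.
Qed.

(* The finitely many relations X only meet a finite part of the dual basis, which is
   merged into a single finitely presented module before it is factored. *)
Lemma dual_basis_quotient P Q m (X : 'I_m -> P) (p : {linear P -> Q}) :
  dual_basis P -> surj p -> (forall x, p x = 0 <-> span X x) -> dual_basis Q.
Proof.
move=> [I [G [a [b [fpG ab]]]]] psurj pX.
have [A AP] := choice ab.
pose J := undup (flatten [seq A (X k) | k <- enum 'I_m]).
have uJ : uniq J by exact: undup_uniq.
have JX k i : i \notin J -> b i (X k) = 0.
  move=> iJ; have [_ bA _] := AP (X k); apply: bA; apply: contra iJ => iA.
  rewrite mem_undup; apply/flattenP; exists (A (X k)) => //.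
  by apply: map_f; rewrite mem_enum.
have [F [b' [a' [fpF ab']]]] := finite_part_factors a b J fpG.
(* The support of each [X k] lies in [J], so [a' \o b'] fixes the relations; hence [a'] and [b']
   descend to maps between [Q] and the quotient [F'] of [F]. *)
have abX k : a' (b' (X k)) = X k.
  have [uA bA xA] := AP (X k); rewrite ab' [RHS]xA.
  apply: (@big_support _ _ (fun i => a i (b i (X k)))) => // i.
    by move=> /JX ->; rewrite linear0.
  by move=> /bA ->; rewrite linear0.
have [F' [q [qsurj qX]]] := quotient_span (fun k => b' (X k)).
have [b0 b0E] : exists b0 : {linear Q -> F'}, forall x, b0 (p x) = q (b' x).
  apply: (factor_through (f := q \o b')) => // x /pX[c ->] /=.
  apply/qX; exists c; rewrite linear_sum; apply: eq_bigr => k _; exact: linearZ.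
have [a0 a0E] : exists a0 : {linear F' -> Q}, forall y, a0 (q y) = p (a' y).
  apply: (factor_through (f := p \o a')) => // y /qX[c ->] /=.
  apply/pX; exists c; rewrite linear_sum; apply: eq_bigr => k _.
  by rewrite linearZ abX.
(* Outside [J] the map [b i] kills the relations and descends to [Q]. Indices in [J] get the zero
   map, as their contribution is carried by [F'], at index [None]. *)
have bP i : exists g : {linear Q -> G i},
    forall x, g (p x) = if i \in J then 0 else b i x.
  case: (boolP (i \in J)) => iJ; first by exists \0.
  apply: (factor_through (f := b i)) => // x /pX[c ->].
  by rewrite linear_sum big1 // => k _; rewrite linearZ /= JX ?scaler0.
have {bP} [b1 b1E] := dep_choice bP.
pose G' (o : option I) : modR := if o is Some i then G i else F'.
pose a1 (o : option I) : {linear G' o -> Q} :=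
  match o with Some i => (p \o a i : {linear G i -> Q}) | None => a0 end.
pose b2 (o : option I) : {linear Q -> G' o} :=
  match o with Some i => b1 i | None => b0 end.
exists (option I), G', a1, b2; split=> [[i|]|y]; first exact: fpG.
  exact: (fin_presented_quotient fpF qsurj qX).
have [x <-] := psurj y; have [uA bA xA] := AP x.
pose A' := [seq i <- A x | i \notin J].
have uA' : uniq A' by rewrite filter_uniq.
have A'J i : i \in A' -> i \notin J by rewrite mem_filter => /andP[].
exists (None :: map Some A'); split.
- rewrite /= map_inj_uniq; last by move=> i j [].
  by rewrite uA' andbT; apply/mapP => -[].
- move=> [i|//]; rewrite in_cons /= mem_map; last by move=> j k [].
  rewrite mem_filter negb_and negbK b1E; case: ifP => //= _; exact: bA.
- rewrite big_cons /= b0E a0E ab' big_map /=.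
  rewrite [X in _ + X](_ : _ = p (\sum_(i <- A') a i (b i x))).
    rewrite -linearD -big_cat; congr (p _); rewrite {1}xA.
    apply: (@big_support _ _ (fun i => a i (b i x))) => //.
    + rewrite cat_uniq uJ uA' andbT; apply/hasPn => i /A'J; exact.
    + by move=> i /bA ->; rewrite linear0.
    + move=> i; rewrite mem_cat mem_filter negb_or => /andP[-> /=] /bA ->.
      exact: linear0.
  rewrite linear_sum !big_seq; apply: eq_bigr => i /A'J/negPf iJ.
  by rewrite b1E iJ.
Qed.

End DualBasis.

(* Terms built from one generator by the module operations and by solving finite
   systems of linear equations; their values in a module form a pure submodule, and
   there is only a set of such terms. *)
Inductive pure_term (R : pzRingType) : Type :=
| Generator
| Zero
| Add of pure_term R & pure_term R
| Scale of R^c & pure_term R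
| Solution n m (r : 'I_n -> 'I_m -> R^c) (b : 'I_m -> pure_term R) (j : 'I_n).

(** * Existence of preenvelopes of the regular module *)

Section Preenvelope.
Variable R : pzRingType.
Notation modR := (lmodType R^c).
Implicit Types M N D : modR.

Lemma pure_term_eval M (x : M) : exists ev : pure_term R -> M,
  [/\ ev (Generator R) = x, ev (Zero R) = 0,
      forall s t, ev (Add s t) = ev s + ev t,
      forall r t, ev (Scale r t) = r *: ev t &
      forall n m (r : 'I_n -> 'I_m -> R^c) (b : 'I_m -> pure_term R),
        (exists y : 'I_n -> M, forall k, \sum_j r j k *: y j = ev (b k)) ->
        forall k, \sum_j r j k *: ev (Solution r b j) = ev (b k)].
Proof.
(* Zero is the default value when the system has no solution. *)
have solve n m (r : 'I_n -> 'I_m -> R^c) (b : 'I_m -> M) : exists y : 'I_n -> M,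
    (exists z : 'I_n -> M, forall k, \sum_j r j k *: z j = b k) ->
    forall k, \sum_j r j k *: y j = b k.
  have [[z zb]|nz] := pselect (exists z : 'I_n -> M, forall k, \sum_j r j k *: z j = b k).
    by exists z.
  by exists (fun=> 0) => /nz.
pose sol n m (r : 'I_n -> 'I_m -> R^c) b := projT1 (cid (solve n m r b)).
pose ev := fix ev (t : pure_term R) : M := match t with
  | Generator => x
  | Zero => 0
  | Add s t => ev s + ev t
  | Scale r t => r *: ev t
  | Solution n m r b j => sol n m r (fun k => ev (b k)) j
  end.
exists ev; split=> // n m r b; rewrite /= /sol; case: (cid _) => y /= yP; exact: yP.
Qed.

(* The preenvelope property of R -> D, 1 |-> d, stated for elements. *)
Definition weakly_initial (C : cls R) D (d : D) : Prop :=
  C D /\ forall D' (d' : D'), C D' -> exists g : {linear D -> D'}, g d = d'.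

(** Any element of a module in [C] lies in the pure submodule of values of terms. That submodule is
    determined up to isomorphism by the relation [E] of having equal values, so the product of one
    module for each possible [E] maps to all of them. *)
Lemma weakly_initial_exists (C : cls R) :
  closed_products C -> closed_pure_submodules C ->
  exists D (d : D), weakly_initial C d.
Proof.
move=> Cprod Cpure.
(* The pair [De] realises the quotient of the terms by [E] as a module in [C]. Indexing by the
   relations [E], and not by modules, keeps the product small. *)
pose good (E : pure_term R -> pure_term R -> Prop) (De : {D : modR & pure_term R -> D}) :=
  let e := projT2 De in
  [/\ C (projT1 De), forall y, exists t, e t = y,
      forall s t, e (Add s t) = e s + e t, forall r t, e (Scale r t) = r *: e t &
      forall s t, e s = e t <-> E s t].
have [De DeP] := dep_choice (fun E : {E | exists De, good E De} => proj2_sig E).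
have [S [pr [Sprod /(_ (fun E => projT2 (De E) (Generator R)))[d dE]]]] :=
  product_exists (fun E => projT1 (De E)).
exists S, d; split=> [|M x CM].
  by apply: (Cprod _ _ _ _ _ Sprod) => E; have [] := DeP E.
have [ev [evG ev0 evD evZ evS]] := pure_term_eval x.
have [N [p [psurj pE _ pD pZ]]] := @separated_module R^c _ _ _ _ unit (fun=> M)
  (fun=> ev) (fun=> ev0) (fun=> evD) (fun=> evZ).
have pev s t : p s = p t <-> ev s = ev t by split=> [/pE/(_ tt)|st]; last apply/pE.
have [i iE] : exists i : {linear N -> M}, forall t, i (p t) = ev t.
  by apply: (factor_operations pD pZ evD evZ psurj) => s t /pev.
have CN : C N.
  apply: (Cpure M N i) => //.
    by move=> y z; have [[s <-] [t <-]] := (psurj y, psurj z); rewrite !iE => /pev.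
  move=> n m r b bN [y yb].
  have {bN} bt k : exists t, ev t = b k.
    by have [z <-] := bN k; have [t <-] := psurj z; exists t; rewrite iE.
  (* Purity: the right-hand sides are values of terms, so values of [Solution] terms solve the
     system inside the image of [N]. *)
  have [t tb] := choice bt; exists (fun j => ev (Solution r t j)); split=> [j|k].
    by exists (p (Solution r t j)); rewrite iE.
  by rewrite -tb evS //; exists y => k'; rewrite yb.
have HE : exists De, good (fun s t => ev s = ev t) De.
  by exists (existT _ N p); split=> //=.
have [_ esurj eD eZ eE] := DeP (exist _ _ HE).
have [g gE] : exists g : {linear projT1 (De (exist _ _ HE)) -> M},
    forall t, g (projT2 (De (exist _ _ HE)) t) = ev t.
  by apply: (factor_operations eD eZ evD evZ esurj) => s t /eE.
by exists (g \o pr (exist _ _ HE)); rewrite /= dE gE.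
Qed.

(** This is projectivity of the regular module: a lift [x] of [d] is weakly initial because maps out
    of [D] can be composed with [p]. *)
Lemma weakly_initial_lift (C : cls R) D (d : D) M (p : {linear M -> D}) :
  weakly_initial C d -> C M -> surj p -> exists x : M, weakly_initial C x.
Proof.
move=> [_ dC] CM psurj; have [x xd] := psurj d; exists x; split=> // D' d' /dC dD'.
by have [g gd] := dD' d'; exists (g \o p); rewrite /= xd.
Qed.

Lemma preenvelope_weakly_initial (C : cls R) M (phi : {linear RR R -> M}) :
  preenvelope C phi -> weakly_initial C (phi (1 : R^c)).
Proof.
move=> [CM phiC]; split=> // D d CD.
have [f fE] : exists f : {linear RR R -> D}, forall r : R^c, f r = r *: d.
  by apply: linear_exists => r x y; rewrite scalerDl scalerA.
by have [g gE] := phiC D f CD; exists g; rewrite gE fE scale1r.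
Qed.

Lemma weakly_initial_preenvelope (C : cls R) M (x : M) : weakly_initial C x ->
  exists phi : {linear RR R -> M}, preenvelope C phi.
Proof.
move=> [CM xC].
have [phi phiE] : exists phi : {linear RR R -> M}, forall r : R^c, phi r = r *: x.
  by apply: linear_exists => r y z; rewrite scalerDl scalerA.
exists phi; split=> // D f CD; have [g gx] := xC D (f (1 : R^c)) CD.
exists g => r; rewrite phiE linearZ /= gx -linearZ; congr (f _).
exact: (@mulr1 R^c).
Qed.

End Preenvelope.

(** * Direct limits and maps from finitely presented modules *)

Section DirectLimits.
Variables (R : pzRingType) (I : Type) (le : I -> I -> Prop) (M : I -> lmodType R^c).
Variables (phi : forall i j, le i j -> {linear M i -> M j}) (L : lmodType R^c).
Variable u : forall i, {linear M i -> L}.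
Hypotheses (dsys : directed_system phi) (dlim : is_direct_limit phi u).

(** By directedness the images of the [u i] form a submodule. The quotient map by it and the zero
    map agree on every [u i], hence coincide. *)
Lemma direct_limit_cover y : exists i (x : M i), u i x = y.
Proof.
have [[_ _ [i0] dir] _] := dsys; have [uphi univ] := dlim.
have [||| Q [p [_ pE]]] := @quotient_module _ L (fun y => exists i (x : M i), u i x = y).
- by exists i0, 0; rewrite linear0.
- move=> _ _ [i [x <-]] [j [z <-]]; have [k [ik jk]] := dir i j.
  by exists k, (phi ik x + phi jk z); rewrite linearD !uphi.
- by move=> r _ [i [x <-]]; exists i, (r *: x); rewrite linearZ.
have [|g [_ gU]] := univ Q (fun i => \0); first by [].
by apply/pE; rewrite (gU p) -?(gU \0) // => i x; apply/pE; exists i, x.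
Qed.

(* The universal property is tested on the reduced product of the M k, that is, the
   product modulo the families vanishing from some index on. *)
Lemma direct_limit_eq0 i (x : M i) : u i x = 0 -> exists k (ik : le i k), phi ik x = 0.
Proof.
move=> ux; have [[le_refl le_trans [i0] dir] [phi1 phiC]] := dsys.
have [uphi univ] := dlim.
have [S [pr [Sprod _]]] := product_exists M.
have [||| Q [p [_ pE]]] := @quotient_module _ S
    (fun s => exists k, forall j, le k j -> pr j s = 0).
- by exists i0 => j _; rewrite linear0.
- move=> s t [k sk] [l tl]; have [m [km lm]] := dir k l.
  by exists m => j mj; rewrite linearD sk ?tl ?addr0 //; apply: le_trans mj.
- by move=> r s [k sk]; exists k => j kj; rewrite linearZ sk //= scaler0.
(* [phi] takes a proof of [le]; composing with the identity at [b] shows that the choice of proof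
   does not matter. *)
have phiI a b (h h' : le a b) z : phi h z = phi h' z.
  by rewrite -(phiC _ _ _ h (le_refl b) h') phi1.
(* [t] extends [phi] by zero to incomparable indices, so that each [M a] maps to the full product;
   the reduced product only sees large indices. *)
have tP (ab : I * I) : exists t : {linear M ab.1 -> M ab.2},
    forall (h : le ab.1 ab.2) z, t z = phi h z.
  have [h|nh] := pselect (le ab.1 ab.2); last by exists \0 => h.
  by exists (phi h) => h' z; apply: phiI.
have [t tE] := dep_choice tP.
have [f fE] := dep_choice (fun a => Sprod (M a) (fun b => t (a, b))).
(* [f a z] and [f b (phi h z)] agree at all indices above [b], so the maps [p \o f a] are compatible
   with the system. *)
have [a b h z|g [gE _]] := univ Q (fun a => p \o f a).
  apply/eqP; rewrite -subr_eq0 /= -linearB; apply/eqP/pE; exists b => j bj.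
  rewrite linearB !(fE _).1 (tE (b, j) bj) (tE (a, j) (le_trans _ _ _ h bj)) /=.
  by rewrite (phiC _ _ _ _ _ (le_trans _ _ _ h bj)) subrr.
have /= := gE i x; rewrite ux linear0 => /esym/pE[k kP].
have [j [ij kj]] := dir i k; exists j, ij.
by rewrite -(tE (i, j)) -(fE i).1 kP.
Qed.

(** The images of the finitely many generators lift to one stage [k]. The finitely many relations
    hold in the limit, hence already at a later stage [k2], where the lifts define [g]. *)
Lemma direct_limit_fin_presented (F : lmodType R^c) (f : {linear F -> L}) : fin_presented F ->
  exists i (g : {linear F -> M i}), forall x, f x = u i (g x).
Proof.
move=> /fin_presented_relations[n [m [r [e [re eh eU]]]]].
have [[le_refl le_trans [i0] dir] [_ phiC]] := dsys; have [uphi _] := dlim.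
have bound (l : nat) (s : 'I_l -> I) : exists k, forall j, le (s j) k.
  elim: l s => [|l IH] s; first by exists i0 => -[].
  have [k sk] := IH (fun j => s (lift ord0 j)); have [k' [k0 kk]] := dir (s ord0) k.
  exists k' => j; case: (unliftP ord0 j) => [j' ->|->] //.
  exact: le_trans (sk j') kk.
have [s sP] := dep_choice (fun j => direct_limit_cover (f (e j))).
have [x xP] := dep_choice sP; have [k sk] := bound _ s.
pose z j := phi (sk j) (x j).
have zE j : u k (z j) = f (e j) by rewrite uphi.
have zr l : u k (\sum_j r j l *: z j) = 0.
  transitivity (f (\sum_j r j l *: e j)); last by rewrite re linear0.
  by rewrite !linear_sum; apply: eq_bigr => j _; rewrite !linearZ /= zE.
have [s' {}sP] := dep_choice (fun l => direct_limit_eq0 (zr l)).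
have [ks' s'P] := dep_choice sP; have [k1 s'k1] := bound _ s'.
have [k2 [kk2 k12]] := dir k k1.
have [|g gE] := eh _ (fun j => phi kk2 (z j)).
  move=> l; have s'k2 := le_trans _ _ _ (s'k1 l) k12.
  transitivity (phi kk2 (\sum_j r j l *: z j)).
    by rewrite linear_sum; apply: eq_bigr => j _; rewrite linearZ.
  by rewrite -(phiC _ _ _ (ks' l) s'k2) s'P linear0.
exists k2, g; apply: (eU _ f (u k2 \o g)) => j.
by rewrite /= gE uphi zE.
Qed.

End DirectLimits.

(** * Torsion pairs with a pure projective preenvelope *)

Section TorsionPairs.
Variables (R : pzRingType) (T F : cls R).
Notation modR := (lmodType R^c).
Hypothesis TF : torsion_pair T F.
Implicit Types M N P Q D C : modR.

Lemma torsion_surj M N (p : {linear M -> N}) : surj p -> T M -> T N.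
Proof.
move=> psurj TM; apply/TF.1 => Y FY f y; have [x <-] := psurj y.
exact: (TF.1 M).1 TM Y FY (f \o p) x.
Qed.

Lemma torsion_coproduct (I : Type) (M : I -> modR) (S : modR)
    (inj : forall i, {linear M i -> S}) :
  is_coproduct inj -> (forall i, T (M i)) -> T S.
Proof.
move=> Sc TM; apply/TF.1 => Y FY f s; have [g [_ gU]] := Sc Y (fun=> \0).
rewrite (gU f) -?(gU \0) // => i x.
exact: (TF.1 (M i)).1 (TM i) Y FY (f \o inj i) x.
Qed.

Lemma torsion_free_injective M N (i : {linear N -> M}) : injective i -> F M -> F N.
Proof.
move=> iinj FM; apply/TF.2 => X TX f x; apply: iinj; rewrite linear0.
exact: (TF.2 M).1 FM X TX (i \o f) x.
Qed.

Lemma torsion_free_product : closed_products F.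
Proof.
move=> I M S pr FM Sp; apply/TF.2 => X TX f x.
have [g [_ gU]] := Sp X (fun=> \0).
rewrite (gU f) -?(gU \0) // => i y; first exact: linear0.
exact: (TF.2 (M i)).1 (FM i) X TX (pr i \o f) y.
Qed.

Section Generator.
Variables (C : modR) (c : C).
Hypotheses (cC : weakly_initial T c) (ppC : pure_projective C).

Lemma torsion_Gen M : T M <-> Gen C M.
Proof.
have [TC ext] := cC; split=> [TM|[I [S [inj [Sc [e esurj]]]]]]; last first.
  exact: torsion_surj esurj (torsion_coproduct Sc (fun=> TC)).
(* One copy of [C] for each element [x] of [M], mapped so that [c] goes to [x]. *)
have [S [inj Sc]] := coproduct_exists (fun _ : M => C).
have [h hE] := dep_choice (fun x : M => ext M x TM).
have [e [eE _]] := Sc M h.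
by exists M, S, inj; split=> //; exists e => x; exists (inj x c); rewrite eE hE.
Qed.

(* The module Q is the pushout of the preenvelope R^n -> C^n along the presentation
   R^m -> R^n -> G, and so a T-preenvelope of the finitely presented module G. *)
Lemma relations_preenvelope n m (r : 'I_n -> 'I_m -> R^c) :
  exists Q (y : 'I_n -> Q),
    [/\ T Q, dual_basis Q, forall k, \sum_j r j k *: y j = 0 &
        forall D (d : 'I_n -> D), T D -> (forall k, \sum_j r j k *: d j = 0) ->
          exists h : {linear Q -> D}, forall j, h (y j) = d j].
Proof.
have [TC ext] := cC; have [S [inj Sc]] := coproduct_exists (fun _ : 'I_n => C).
pose X k := \sum_j r j k *: inj j c.
have [Q [p [psurj pX]]] := quotient_span X.
exists Q, (fun j => p (inj j c)); split.
- exact: torsion_surj psurj (torsion_coproduct Sc (fun=> TC)).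
- apply: (dual_basis_quotient _ psurj pX); apply: (dual_basis_coproduct Sc) => _.
  exact/pure_projective_dual_basis.
- move=> k; transitivity (p (X k)); last exact/pX/span_gen.
  by rewrite linear_sum; apply: eq_bigr => j _; rewrite linearZ.
- move=> D d TD dr; have [h hE] := dep_choice (fun j => ext D (d j) TD).
  have [f [fE _]] := Sc D h.
  have [|g gE] := factor_through (f := f) psurj; last first.
    by exists g => j; rewrite gE fE.
  move=> x /pX[a ->]; rewrite linear_sum big1 // => k _; rewrite linearZ /=.
  rewrite linear_sum (_ : \sum_i _ = 0) ?scaler0 // -[RHS](dr k).
  by apply: eq_bigr => j _; rewrite linearZ /= fE hE.
Qed.

Lemma torsion_enough_pure_projectives : enough_pure_projectives T.
Proof.
move=> D TD.
pose rel n m (rd : ('I_n -> 'I_m -> R^c) * ('I_n -> D)) :=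
  forall k, \sum_j rd.1 j k *: rd.2 j = 0.
pose X := {nm : nat * nat & {rd | rel nm.1 nm.2 rd}}.
have QP (i : X) : exists Qh : {Q : modR & {linear Q -> D}},
    [/\ T (projT1 Qh), dual_basis (projT1 Qh) &
      exists y, (forall k, \sum_j (projT1 (tagged i)).1 j k *: y j = 0) /\
        forall j, projT2 Qh (y j) = (projT1 (tagged i)).2 j].
  case: i => -[n m] [[r d] /= dr]; have [Q [y [TQ dQ yr ext]]] := relations_preenvelope r.
  by have [h hE] := ext D d TD dr; exists (existT _ Q h); split=> //; exists y.
have {QP} [Q QP] := dep_choice QP.
have [P [inj Pc]] := coproduct_exists (fun i => projT1 (Q i)).
have [p [pE _]] := Pc D (fun i => projT2 (Q i)).
have lift n m (r : 'I_n -> 'I_m -> R^c) (d : 'I_n -> D) :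
    (forall k, \sum_j r j k *: d j = 0) ->
    exists y : 'I_n -> P, (forall k, \sum_j r j k *: y j = 0) /\ forall j, p (y j) = d j.
  move=> dr; pose i : X := existT _ (n, m) (exist (rel n m) (r, d) dr).
  have [_ _ [y [yr yd]]] := QP i; exists (fun j => inj i (y j)).
  split=> [k|j]; last by rewrite pE yd.
  rewrite -[RHS](linear0 (inj i)) -(yr k) linear_sum; apply: eq_bigr => j _.
  by rewrite linearZ.
exists P, p; split; [| |split].
- apply/pure_projective_dual_basis; apply: (dual_basis_coproduct Pc) => i.
  by have [] := QP i.
- by apply: (torsion_coproduct Pc) => i; have [] := QP i.
(* Surjectivity is the case of one unknown and no equations. *)
- move=> d; have [|y [_ yd]] := @lift 1 0 (fun _ _ => 0) (fun=> d); first by case.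
  by exists (y ord0); rewrite yd.
- move=> n m r b pb [x xb].
  (* Purity of the kernel: [p] turns [x] into a solution in [D] of the homogeneous system.
     Subtracting a homogeneous lift [y] of it moves [x] into the kernel without changing the
     right-hand sides. *)
  have [k|y [yr yd]] := @lift n m r (fun j => p (x j)).
    by rewrite -[RHS](pb k) -xb linear_sum; apply: eq_bigr => j _; rewrite linearZ.
  exists (fun j => x j - y j); split=> [j|k]; first by rewrite linearB yd subrr.
  transitivity (\sum_j r j k *: x j - \sum_j r j k *: y j); last by rewrite xb yr subr0.
  by rewrite -sumrB; apply: eq_bigr => j _; rewrite scalerBr.
Qed.

Lemma torsion_free_direct_limits : closed_direct_limits F.
Proof.
move=> I le M phi L u dsys FM dlim; have [TC ext] := cC.
have C0 (f : {linear C -> L}) x : f x = 0.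
  have [J [G [a [b [fpG ab]]]]] := (pure_projective_dual_basis C).1 ppC.
  have [A [_ _ ->]] := ab x; rewrite linear_sum big1 // => i _.
  have [k [g gE]] := direct_limit_fin_presented dsys dlim (f \o a i) (fpG i).
  have /= gb0 := (TF.1 C).1 TC (M k) (FM k) (g \o b i) x.
  by have /= -> := gE (b i x); rewrite gb0 linear0.
(* Every element of a module in [T] is the image of [c] under a map from [C], so it suffices that
   all maps from [C] to [L] vanish. *)
apply/TF.2 => X TX f x; have [g <-] := ext X x TX.
exact: C0 (f \o g) c.
Qed.

Lemma torsion_free_definable : definable F.
Proof.
split; [exact: torsion_free_product | | exact: torsion_free_direct_limits].
move=> M N i iinj _; exact: torsion_free_injective iinj.
Qed.

End Generator.
End TorsionPairs.

Theorem theorem1p8 (R : pzRingType) (T F : cls R) :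
  torsion_pair T F -> definable T ->
  [/\ (exists (C : lmodType R^c) (phi : {linear RR R -> C}),
          preenvelope T phi /\ pure_projective C)
        <-> enough_pure_projectives T,
      enough_pure_projectives T <->
        (exists P : lmodType R^c, pure_projective P /\ forall M, T M <-> Gen P M) &
      (exists (C : lmodType R^c) (phi : {linear RR R -> C}),
          preenvelope T phi /\ pure_projective C) -> elementary T F].
Proof.
move=> TF Tdef; have [Tprod Tpure _] := Tdef.
(* [D0] need not be pure projective; it serves as the target of epimorphisms from pure projective
   modules in [T], along which [d0] is lifted. *)
have [D0 [d0 d0P]] := weakly_initial_exists Tprod Tpure.
have TD0 : T D0 by case: d0P.
have enough_initial : enough_pure_projectives T ->
    exists (C : lmodType R^c) (c : C), weakly_initial T c /\ pure_projective C.
  move=> /(_ D0 TD0)[P [p [ppP TP [psurj _]]]]; exists P.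
  by have [x xP] := weakly_initial_lift d0P TP psurj; exists x.
split.
- split=> [[C [phi [phiP ppC]]]|/enough_initial[C [c [cC ppC]]]].
    exact: (torsion_enough_pure_projectives TF (preenvelope_weakly_initial phiP) ppC).
  by have [phi phiP] := weakly_initial_preenvelope cC; exists C, phi.
- split=> [/enough_initial[C [c [cC ppC]]]|[P [ppP TGen]]].
    by exists C; split=> // M; exact: (torsion_Gen TF cC).
  have [I [S [inj [Sc [e esurj]]]]] := (TGen D0).1 TD0.
  (* The coproduct [S] of copies of [P] is itself in [Gen P], through its identity map. *)
  have TS : T S by apply/TGen; exists I, S, inj; split=> //; exists idfun => x; exists x.
  have [x xP] := weakly_initial_lift d0P TS esurj.
  apply: (torsion_enough_pure_projectives TF xP); apply/pure_projective_dual_basis.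
  by apply: (dual_basis_coproduct Sc) => _; apply/pure_projective_dual_basis.
- move=> [C [phi [phiP ppC]]]; split=> //.
  exact: (torsion_free_definable TF (preenvelope_weakly_initial phiP) ppC).
Qed.
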